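(* Let $p\ge7$ be a prime. Then the set $$\mathcal K_p=\left\{x\in\mathbb Z_p^\times:\ x=\sum_{i=0}^\infty x_ip^i,\ x^{-1}=\sum_{i=0}^\infty y_ip^i\text{ with }x_i,y_i\text{ even for all }i\right\}$$ is uncountable.
   Context: $\mathbb Z_p$ denotes the $p$-adic integers; the digits $x_i,y_i$ are the canonical $p$-adic digits in $\{0,1,\dots,p-1\}$. *)

(* Defs.v *)
From HB Require Import structures.
From mathcomp Require Import all_boot all_order all_algebra.
From mathcomp Require Import all_classical all_reals all_analysis.

Set Implicit Arguments.
Unset Strict Implicit.
Unset Printing Implicit Defensive.

Import GRing.Theory.

Local Open Scope classical_set_scope.
Local Open Scope ring_scope.

(* The ring of p-adic integers as the inverse limit of the rings Z/p^(n+1):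
   component n is the residue modulo p^(n+1). The exponent is shifted because
   the modulus p^0 = 1 is degenerate in mathcomp ('Z_1 is Z/2). The definitions
   make sense for every p : nat, but are only meaningful for p prime. *)
Record padic_int (p : nat) := PadicInt {
  residue :> forall n, 'Z_(p ^ n.+1);
  residue_compat : forall n,
    (residue n.+1 : nat)%:R = residue n :> 'Z_(p ^ n.+1)
}.

Section PadicRing.
Variable p : nat.
Implicit Types x y z : padic_int p.

Lemma padic_intP x y : (forall n, residue x n = residue y n) -> x = y.
Proof.
case: x y => [x xP] [y yP] /= xy.
have {}xy : x = y by exact: functional_extensionality_dep.
by case: y / xy yP => yP; congr PadicInt; exact: Prop_irrelevance.
Qed.

Fact Zp_trunc_dvd n :
  ((Zp_trunc (p ^ n.+1)).+2 %| (Zp_trunc (p ^ n.+2)).+2)%N.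
Proof.
case: p => [|[|q]]; first by rewrite !exp0n.
  by rewrite !exp1n.
have gt1 m : (1 < q.+2 ^ m.+1)%N by rewrite -(exp1n m.+1) ltn_exp2r.
by rewrite !Zp_cast// (expnS _ n.+1) dvdn_mull.
Qed.

Fact reduceE n (k : nat) :
  (k%:R : 'Z_(p ^ n.+1)) = inZp k.
Proof. by rewrite Zp_nat. Qed.

Fact reduce_mod n (k : nat) :
  (inZp (k %% (Zp_trunc (p ^ n.+2)).+2) : 'Z_(p ^ n.+1)) = inZp k.
Proof. by apply: val_inj => /=; rewrite modn_dvdm// Zp_trunc_dvd. Qed.

Fact reduceD n (a b : 'Z_(p ^ n.+2)) :
  ((a + b)%R : nat)%:R = (a : nat)%:R + (b : nat)%:R :> 'Z_(p ^ n.+1).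
Proof. by rewrite -natrD !reduceE -[RHS]reduce_mod. Qed.

Fact reduceM n (a b : 'Z_(p ^ n.+2)) :
  ((a * b)%R : nat)%:R = (a : nat)%:R * (b : nat)%:R :> 'Z_(p ^ n.+1).
Proof. by rewrite -natrM !reduceE -[RHS]reduce_mod. Qed.

Fact reduceN n (a : 'Z_(p ^ n.+2)) :
  ((- a)%R : nat)%:R = - (a : nat)%:R :> 'Z_(p ^ n.+1).
Proof. by apply/eqP; rewrite -addr_eq0 -reduceD addNr. Qed.

Definition padic_zero : padic_int p.
Proof. by apply: (@PadicInt p (fun=> 0)). Defined.

Definition padic_one : padic_int p.
Proof. by apply: (@PadicInt p (fun=> 1)). Defined.

Definition padic_opp x : padic_int p.
Proof.
by apply: (@PadicInt p (fun n => - x n)) => n; rewrite reduceN residue_compat.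
Defined.

Definition padic_add x y : padic_int p.
Proof.
apply: (@PadicInt p (fun n => x n + y n)) => n.
by rewrite reduceD !residue_compat.
Defined.

Definition padic_mul x y : padic_int p.
Proof.
apply: (@PadicInt p (fun n => x n * y n)) => n.
by rewrite reduceM !residue_compat.
Defined.

HB.instance Definition _ := gen_eqMixin (padic_int p).
HB.instance Definition _ := gen_choiceMixin (padic_int p).

Fact padic_addA : associative padic_add.
Proof. by move=> x y z; apply: padic_intP => n /=; rewrite addrA. Qed.
Fact padic_addC : commutative padic_add.
Proof. by move=> x y; apply: padic_intP => n /=; rewrite addrC. Qed.
Fact padic_add0 : left_id padic_zero padic_add.
Proof. by move=> x; apply: padic_intP => n /=; rewrite add0r. Qed.
Fact padic_addN : left_inverse padic_zero padic_opp padic_add.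
Proof. by move=> x; apply: padic_intP => n /=; rewrite addNr. Qed.

HB.instance Definition _ := GRing.isZmodule.Build (padic_int p)
  padic_addA padic_addC padic_add0 padic_addN.

Fact padic_mulA : associative padic_mul.
Proof. by move=> x y z; apply: padic_intP => n /=; rewrite mulrA. Qed.
Fact padic_mulC : commutative padic_mul.
Proof. by move=> x y; apply: padic_intP => n /=; rewrite mulrC. Qed.
Fact padic_mul1 : left_id padic_one padic_mul.
Proof. by move=> x; apply: padic_intP => n /=; rewrite mul1r. Qed.
Fact padic_mulDl : left_distributive padic_mul padic_add.
Proof. by move=> x y z; apply: padic_intP => n /=; rewrite mulrDl. Qed.
Fact padic_one_neq0 : padic_one != padic_zero.
Proof.
by apply/eqP => /(congr1 (fun x => residue x 0)) /= /eqP; rewrite oner_eq0.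
Qed.

HB.instance Definition _ := GRing.Zmodule_isComNzRing.Build (padic_int p)
  padic_mulA padic_mulC padic_mul1 padic_mulDl padic_one_neq0.

Definition padic_unit : {pred padic_int p} :=
  [pred x | `[< exists y, y * x = 1 >]].

Definition padic_inv x : padic_int p :=
  if pselect (exists y, y * x = 1) is left xU then projT1 (cid xU) else x.

Fact padic_mulVx : {in padic_unit, left_inverse 1 padic_inv *%R}.
Proof.
move=> x /asboolP xU; rewrite /padic_inv.
by case: pselect => // xU'; case: (cid xU').
Qed.
Fact padic_unitPl x y : y * x = 1 -> padic_unit x.
Proof. by move=> yx1; apply/asboolP; exists y. Qed.
Fact padic_inv_out : {in [predC padic_unit], padic_inv =1 id}.
Proof.
by move=> x /asboolP xU; rewrite /padic_inv; case: pselect.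
Qed.

HB.instance Definition _ := GRing.ComNzRing_hasMulInverse.Build (padic_int p)
  padic_mulVx padic_unitPl padic_inv_out.

(* The p-adic topology: the cosets x + p^N Z_p form a basis of the
   neighbourhoods of x. *)
Definition padic_coset x (N : nat) : set (padic_int p) :=
  [set x + p%:R ^+ N * z | z in [set: padic_int p]].

Definition padic_nbhs x : set_system (padic_int p) :=
  filter_from [set: nat] (padic_coset x).

HB.instance Definition _ := hasNbhs.Build (padic_int p) padic_nbhs.

Fact padic_coset_center x N : padic_coset x N x.
Proof. by exists 0 => //; rewrite mulr0 addr0. Qed.

Fact padic_coset_leq x M N :
  (M <= N)%N -> padic_coset x N `<=` padic_coset x M.
Proof.
move=> MN _ [z _ <-]; exists (p%:R ^+ (N - M) * z) => //.
by rewrite mulrA -exprD subnKC.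
Qed.

Fact padic_nbhs_filter x : ProperFilter (padic_nbhs x).
Proof.
apply: filter_from_proper; last by move=> N _; exists x; exact: padic_coset_center.
apply: filter_from_filter; first by exists 0%N.
move=> M N _ _; exists (maxn M N) => // y xy.
by split; apply: padic_coset_leq xy; rewrite (leq_maxl, leq_maxr).
Qed.

Fact padic_nbhs_singleton x (A : set (padic_int p)) : padic_nbhs x A -> A x.
Proof. by case=> N _; apply; exact: padic_coset_center. Qed.

Fact padic_nbhs_nbhs x (A : set (padic_int p)) :
  padic_nbhs x A -> padic_nbhs x (padic_nbhs^~ A).
Proof.
case=> N _ xA; exists N => // _ [z _ <-]; exists N => // _ [t _ <-].
by apply: xA; exists (z + t) => //; rewrite mulrDr addrA.
Qed.

HB.instance Definition _ := Nbhs_isNbhsTopological.Build (padic_int p)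
  padic_nbhs_filter padic_nbhs_singleton padic_nbhs_nbhs.

End PadicRing.

(* The digits d i in {0, ..., p - 1} are those of x: x = \sum_i d_i p^i in the
   p-adic topology. *)
Definition padic_expansion (p : nat) (x : padic_int p) (d : nat -> 'I_p) : Prop :=
  series (fun i => (d i)%:R * p%:R ^+ i : padic_int p) @ \oo --> x.

Definition even_digits_inv (p : nat) : set (padic_int p) :=
  [set x | x \is a GRing.unit /\
    exists d e : nat -> 'I_p,
      [/\ padic_expansion x d, padic_expansion x^-1 e &
          forall i, ~~ odd (d i) /\ ~~ odd (e i)] ].
Arguments even_digits_inv p : clear implicits.

(* Main.v *)
Require Import Defs.
From mathcomp Require Import all_boot all_order all_algebra.
From mathcomp Require Import all_classical all_reals all_analysis.
From mathcomp Require Import zify ring.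

(** Choose even digits [x0], [y0] with [x0 * y0 = 1] and [x0 <> y0], [x0 <> - y0]
   modulo [p], and build the digits of [x] and [x^-1] simultaneously. If
   [X * Y = 1 + c p^n], then appending digits [a] and [b] at position [n] keeps
   the product equal to 1 modulo [p^(n+1)] exactly when
   [x0 b + y0 a = - c] modulo [p]. Put [p = 2m + 1], [a = 2i], [b = 2j] with
   [0 <= i, j <= m]: as [i] varies, [j] runs through an arithmetic progression of
   length [m + 1] modulo [p] whose step is neither 0, 1 nor -1, and such a
   progression meets [[0, m]] at least twice. Hence there are at each
   position two admissible choices with different [a], which allows [x] to be
   diagonalised against any enumeration of the set. *)

Set Implicit Arguments.
Unset Strict Implicit.
Unset Printing Implicit Defensive.

Import GRing.Theory.
Local Open Scope classical_set_scope.
Local Open Scope ring_scope.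

(** * Walks modulo [2m + 1] and the interval [[[0, m]]] *)

(** A step of length [r <= m] that wraps around lands in [[[0, m]]]. So a run outside [[[0, m]]]
    never wraps: it climbs by [r] each time within the [m] residues above [m]. *)
Lemma walk_run_short (m r s i k : nat) :
  (r <= m)%N ->
  (forall j, i <= j <= i + k -> m < (s + r * j) %% m.*2.+1)%N ->
  (r * k < m)%N.
Proof.
move=> rm run.
have stay j : (j <= k)%N ->
    ((s + r * (i + j)) %% m.*2.+1 = (s + r * i) %% m.*2.+1 + r * j)%N.
  elim: j => [|j IH] jk; first by rewrite addn0 muln0 addn0.
  have {}IH := IH (ltnW jk).
  have := run (i + j.+1)%N.
  have -> : (s + r * (i + j.+1) = (s + r * (i + j)) + r)%N by lia.
  rewrite -modnDml IH => run1.
  have {}run1 : (m < ((s + r * i) %% m.*2.+1 + r * j + r) %% m.*2.+1)%N.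
    by apply: run1; lia.
  have lt : ((s + r * (i + j)) %% m.*2.+1 < m.*2.+1)%N by rewrite ltn_mod.
  rewrite IH in lt.
  set t := (_ + r * j)%N in lt run1 *.
  case: (ltnP (t + r) m.*2.+1) => tr; first by rewrite modn_small// /t; lia.
  have : ((t + r) %% m.*2.+1 = t + r - m.*2.+1)%N.
    have -> : (t + r = (t + r - m.*2.+1) + m.*2.+1)%N by lia.
    by rewrite modnDr modn_small; lia.
  by lia.
have := stay k (leqnn k).
have : ((s + r * (i + k)) %% m.*2.+1 < m.*2.+1)%N by rewrite ltn_mod.
by have := run i; lia.
Qed.

(* False for [m = 4]: modulo 9 with step 3, the walk 5, 8, 2, 5, 8 meets [[0, 4]]
   only once; 9 is not prime, so this case does not arise. *)
Lemma walk_hits_twice (m r s : nat) :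
  (3 <= m)%N -> m != 4 -> (2 <= r <= m)%N ->
  exists i j, [/\ (i < j <= m)%N, ((s + r * i) %% m.*2.+1 <= m)%N &
                  ((s + r * j) %% m.*2.+1 <= m)%N].
Proof.
move=> m3 m4 /andP[r2 rm]; apply: contrapT => nohits.
pose f i := ((s + r * i) %% m.*2.+1)%N.
have run i k : (forall j, i <= j <= i + k -> m < f j)%N -> (r * k < m)%N.
  exact: walk_run_short.
have [t [tm ft]] : exists t, (t <= m)%N /\ (f t <= m)%N.
  apply: contrapT => none.
  have : (r * m < m)%N.
    apply: (run 0%N) => j jm; rewrite ltnNge; apply/negP => fj.
    by apply: none; exists j.
  by nia.
have out j : (j <= m)%N -> j != t -> (m < f j)%N.
  move=> jm jt; rewrite ltnNge; apply/negP => fj; apply: nohits.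
  by case: (ltngtP j t) jt => // ?; [exists j, t | exists t, j]; split=> //;
    apply/andP.
have below : (0 < t)%N -> (r * t.-1 < m)%N.
  by move=> t0; apply: (run 0%N) => j jt; apply: out; lia.
have above : (t < m)%N -> (r * (m - t.+1) < m)%N.
  by move=> t0; apply: (run t.+1) => j jt; apply: out; lia.
have [t0|t0] := posnP t; first by rewrite t0 in above; nia.
have [tm'|tm'] := ltnP t m; last by nia.
have {}below := below t0; have {}above := above tm'.
(* The runs before and after the only visit [t] to [[0, m]] stay outside it, so
   [r (m - 2) <= 2 (m - 1)]. *)
have [r3|r3] := leqP 3 r.
  have : (m <= 4)%N by nia.
  move=> m_le; have m_eq : m = 3%N by move: m4 => /eqP; lia.
  (* Here [r = 3] too; the run before [t] forces [t = 1], the run after it [t = 2]. *)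
  by subst m; nia.
have r_eq : r = 2%N by lia.
(* Steps of length 2 cannot both enter and leave [[0, m]] around one point. *)
subst r.
have := out t.-1; have := out t.+1; rewrite /f in ft *.
have -> : (s + 2 * t.+1 = (s + 2 * t.-1 + 2) + 2)%N by lia.
have e : (s + 2 * t = (s + 2 * t.-1) + 2)%N by lia.
rewrite e in ft; rewrite -modnDml => h1 h2; move: ft h1 h2.
rewrite -modnDml.
have lt : ((s + 2 * t.-1) %% m.*2.+1 < m.*2.+1)%N by rewrite ltn_mod.
move: (_ %% _)%N lt => u lt.
case: (ltnP (u + 2) m.*2.+1) => tr.
  by rewrite (modn_small tr); lia.
(* The wrap brings [u + 2] to 0 or 1, so the next point is at most 3, hence at most [m]. *)
have -> : (u + 2 = (u + 2 - m.*2.+1) + m.*2.+1)%N by lia.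
rewrite modnDr (@modn_small (u + 2 - _))%N; last by lia.
by move=> _; rewrite modn_small; lia.
Qed.

(** * Even solutions of a linear equation modulo [p] *)

Lemma Zp_nat_eqP (q a b : nat) : (1 < q)%N ->
  a%:R = b%:R :> 'Z_q <-> (a = b %[mod q])%N.
Proof.
move=> q1; rewrite -!val_Zp_nat//; split=> [->//|ab].
exact: val_inj.
Qed.

Lemma even_solutions (p : nat) (u v c : 'F_p) : prime p -> (7 <= p)%N ->
  u != 0 -> v != 0 -> u != v -> u != - v ->
  exists a b a' b' : 'I_p,
    [/\ a != a', [&& ~~ odd a, ~~ odd b, ~~ odd a' & ~~ odd b'],
        u * b%:R + v * a%:R = c & u * b'%:R + v * a'%:R = c].
Proof.
move=> p_pr p7 u0 v0 uv uNv.
have p_odd : odd p by case: (even_prime p_pr) => // p2; rewrite p2 in p7.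
pose m := p./2.
have pE : p = m.*2.+1 by rewrite -[LHS]odd_double_half p_odd.
have m4 : m != 4 by apply: contraTneq p_pr => m4; rewrite pE m4.
have m3 : (3 <= m)%N by lia.
have valF (z : 'F_p) : z = (z : nat)%:R by rewrite natr_Zp.
have val_lt (z : 'F_p) : (z < p)%N by rewrite -[ltnRHS](Fp_cast p_pr) ltn_ord.
have two0 : (2%:R : 'F_p) != 0.
  by rewrite -(dvdn_pcharf (pchar_Fp p_pr)) gtnNdvd//; lia.
have val_nat k : (k%:R : 'F_p) = (k %% p)%N :> nat by exact: val_Fp_nat.
have walk (s r : 'F_p) : (2 <= r <= m)%N ->
    exists i j, [/\ (i < j <= m)%N, (((s + r * i%:R)%R : 'F_p) <= m)%N &
                    (((s + r * j%:R)%R : 'F_p) <= m)%N].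
  move=> /(@walk_hits_twice _ _ s m3 m4)[i [j []]]; rewrite -pE => ij hi hj.
  by exists i, j; split=> //; rewrite (valF s) (valF r) -natrM -natrD val_nat.
have build (i : nat) (z : 'F_p) : (i <= m)%N -> (z <= m)%N ->
    u * z + v * i%:R = c / 2%:R ->
    exists a b : 'I_p, [/\ a = i.*2 :> nat, ~~ odd a, ~~ odd b &
      u * b%:R + v * a%:R = c].
  move=> im zm e.
  have ip : (i.*2 < p)%N by lia.
  have zp : (z.*2 < p)%N by lia.
  exists (Ordinal ip), (Ordinal zp); rewrite /= !odd_double; split=> //.
  rewrite -!muln2 !natrM -valF !mulrA -mulrDl e mulfVK//.
have combine (i j : nat) (z w : 'F_p) : (i <= m)%N -> (j <= m)%N -> i != j ->
    (z <= m)%N -> (w <= m)%N -> u * z + v * i%:R = c / 2%:R ->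
    u * w + v * j%:R = c / 2%:R ->
  exists a b a' b' : 'I_p,
    [/\ a != a', [&& ~~ odd a, ~~ odd b, ~~ odd a' & ~~ odd b'],
        u * b%:R + v * a%:R = c & u * b'%:R + v * a'%:R = c].
  move=> im jm ij zm wm ez ew.
  have [a [b [ai oa ob ab]]] := build _ _ im zm ez.
  have [a' [b' [aj oa' ob' ab']]] := build _ _ jm wm ew.
  exists a, b, a', b'; split=> //; last by rewrite oa ob oa' ob'.
  by rewrite -val_eqE/= ai aj; apply: contra ij => /eqP/double_inj->.
(* Solving [u * z + v * i = c / 2] for [z] gives [z = s + r * i]. Here [u != - v] excludes [r = 1]
   and [u != v] excludes [r = -1]. *)
pose r : 'F_p := - (v / u); pose s : 'F_p := c / 2%:R / u.
have [rm|mr] := leqP r m.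
  have r2 : (2 <= r <= m)%N.
    rewrite rm andbT; case E : (r : nat) => [|[|//]]; exfalso.
      move: (valF r); rewrite E => /eqP; rewrite oppr_eq0 mulf_eq0 invr_eq0.
      by rewrite (negPf v0) (negPf u0).
    move: (valF r); rewrite E /r => /eqP; rewrite eqr_oppLR => /eqP e.
    by case/eqP: uNv; rewrite -[v](mulfVK u0) e mulN1r opprK.
  have [i [j [/andP[ij jm] hi hj]]] := walk s r r2.
  apply: (combine i j _ _ _ jm _ hi hj); [by lia|by lia| |];
    by rewrite /s /r; field; rewrite ?u0 ?two0.
(* For [r > m] the walk is traversed backwards: [i] becomes [m - i], the step [- r] and the start
   [s + r * m]. *)
have r2 : (2 <= (- r)%R <= m)%N.
  have rN : ((- r)%R : nat) = (p - r)%N.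
    have -> : - r = (p - r)%:R.
      by rewrite natrB 1?ltnW// pchar_Fp_0// sub0r -valF.
    rewrite val_nat modn_small//; lia.
  rewrite rN; have := val_lt r => rp; apply/andP; split; last by lia.
  rewrite ltnNge; apply/negP => h.
  have r1 : ((- r)%R : nat) = 1%N by lia.
  move: (valF (- r)); rewrite r1 /r opprK => e.
  by case/eqP: uv; rewrite -[v](mulfVK u0) e mul1r.
have [i [j [/andP[ij jm] hi hj]]] := walk (s + r * m%:R) (- r) r2.
apply: (combine (m - i)%N (m - j)%N _ _ _ _ _ hi hj); [by lia|by lia|by lia| |];
  by rewrite natrB /s /r; [field; rewrite ?u0 ?two0|lia].
Qed.

(** * Lifting inverse pairs by one digit *)

Lemma Fp_nat_eq0 (p k : nat) : prime p -> (k%:R == 0 :> 'F_p) = (p %| k)%N.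
Proof. by move=> p_pr; rewrite -(dvdn_pcharf (pchar_Fp p_pr)). Qed.

Lemma Fp_nat_eqP (p a b : nat) : prime p ->
  a%:R = b%:R :> 'F_p <-> (a = b %[mod p])%N.
Proof.
move=> p_pr; rewrite -!(val_Fp_nat p_pr); split=> [->//|]; exact: val_inj.
Qed.

Lemma even_lifts (p n X Y : nat) : prime p -> (7 <= p)%N ->
  (X * Y = 1 %[mod p ^ n.+1])%N ->
  X%:R != Y%:R :> 'F_p -> X%:R != - Y%:R :> 'F_p ->
  exists a b a' b' : 'I_p,
    [/\ a != a', [&& ~~ odd a, ~~ odd b, ~~ odd a' & ~~ odd b'],
      ((X + a * p ^ n.+1) * (Y + b * p ^ n.+1) = 1 %[mod p ^ n.+2])%N &
      ((X + a' * p ^ n.+1) * (Y + b' * p ^ n.+1) = 1 %[mod p ^ n.+2])%N].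
Proof.
move=> p_pr p7 XY1 XY XNY; set q := (p ^ n.+1)%N in XY1 *.
have q1 : (1 < q)%N by rewrite -(exp1n n.+1) ltn_exp2r ?prime_gt1.
have XY0 : (0 < X * Y)%N.
  by rewrite lt0n; apply/eqP => e; move: XY1; rewrite e mod0n modn_small.
have [c cE] : exists c, (X * Y = 1 + c * q)%N.
  move/eqP: XY1; rewrite eqn_mod_dvd// => /dvdnP[c cE].
  by exists c; lia.
have pq : (p %| q)%N by rewrite /q expnS dvdn_mulr.
have uv1 : X%:R * Y%:R = 1 :> 'F_p.
  by rewrite -natrM cE natrD natrM; move: pq; rewrite -Fp_nat_eq0 // => /eqP->;
    rewrite mulr0 addr0.
have u0 : X%:R != 0 :> 'F_p.
  by apply/eqP => e; move/eqP: uv1; rewrite e mul0r eq_sym oner_eq0.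
have v0 : Y%:R != 0 :> 'F_p.
  by apply/eqP => e; move/eqP: uv1; rewrite e mulr0 eq_sym oner_eq0.
have lift (a b : nat) : X%:R * b%:R + Y%:R * a%:R = - c%:R :> 'F_p ->
    ((X + a * q) * (Y + b * q) = 1 %[mod p ^ n.+2])%N.
  move=> /eqP; rewrite -addr_eq0 -!natrM -!natrD Fp_nat_eq0// => /dvdnP[w wE].
  (* The term [a * b * q ^ 2] vanishes modulo [p * q] because [p] divides [q]. *)
  have [t tE] := dvdnP pq.
  have -> : ((X + a * q) * (Y + b * q) =
             (w + t * (a * b)) * (p * q) + 1)%N.
    transitivity (1 + q * (X * b + Y * a + c) + (t * p) * q * (a * b))%N.
      by rewrite -tE; nia.
    by rewrite wE; nia.
  by rewrite /q -expnS modnMDl.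
have [a [b [a' [b' [aa' ev h h']]]]] :=
  even_solutions (- c%:R) p_pr p7 u0 v0 XY XNY.
by exists a, b, a', b'; split=> //; apply: lift.
Qed.

(** * The initial digits *)

Lemma even_seed (p : nat) : prime p -> (7 <= p)%N ->
  exists x y : 'I_p,
    [/\ ~~ odd x, ~~ odd y, (x * y = 1 %[mod p])%N,
        x%:R != y%:R :> 'F_p & x%:R != - y%:R :> 'F_p].
Proof.
move=> p_pr p7.
have p_odd : odd p by case: (even_prime p_pr) => // p2; rewrite p2 in p7.
(* Since [x * y = 1] modulo [p], [x = y] would give [x ^ 2 = 1] and [x = - y] would give
   [x ^ 2 = -1]; both are tested on the small number [w]. *)
have seed (x y k w : nat) : ~~ odd x -> ~~ odd y -> (x < p)%N -> (y < p)%N ->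
    (x * y = k * p + 1)%N -> (0 < w)%N -> x%:R ^+ 2 = w%:R :> 'F_p ->
    ~~ (p %| w.-1)%N -> ~~ (p %| w.+1)%N ->
  exists x y : 'I_p,
    [/\ ~~ odd x, ~~ odd y, (x * y = 1 %[mod p])%N,
        x%:R != y%:R :> 'F_p & x%:R != - y%:R :> 'F_p].
  move=> ox oy xp yp xy w0 x2 w1 w2.
  have xy1 : x%:R * y%:R = 1 :> 'F_p.
    by rewrite -natrM xy natrD natrM pchar_Fp_0// mulr0 add0r.
  exists (Ordinal xp), (Ordinal yp); split=> //=.
  - by rewrite xy modnMDl.
  - apply: contra w1 => /eqP e; rewrite -Fp_nat_eq0// -subn1 natrB// -x2 expr2.
    by rewrite {2}e xy1 subrr.
  - apply: contra w2 => /eqP e; rewrite -Fp_nat_eq0// -[w.+1]addn1 natrD -x2.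
    by rewrite expr2 {2}e mulrN xy1 addNr.
have dvdF N : (0 < N)%N -> all (fun d => (d < 7)%N || ~~ prime d) (divisors N) ->
    ~~ (p %| N)%N.
  move=> N0 /allP h; apply/negP; rewrite dvdn_divisors// => /h.
  by rewrite p_pr orbF ltnNge p7.
(* The seeds are [2], [-3], [4] and [12] modulo [p]; their inverses are even for
   [p = 3 mod 4], [p = 1 mod 3], [p = 5 mod 8] and [p = 17 mod 24]. *)
have [p4|p4] := eqVneq (p %% 4)%N 3%N.
  apply: (seed 2 (p.+1)./2 1 4)%N => //; try lia.
  - by rewrite -natrX.
  - exact: dvdF.
  - exact: dvdF.
have [p3|p3] := eqVneq (p %% 3)%N 1%N.
  apply: (seed (p - 3) (p.-1 %/ 3) ((p - 4) %/ 3) 9)%N => //; try lia.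
  - have [t tE] : exists t, (p = 3 * t.+1 + 1)%N by exists ((p - 4) %/ 3)%N; lia.
    have -> : (p.-1 %/ 3 = t.+1)%N by lia.
    by have -> : ((p - 4) %/ 3 = t)%N; [lia|nia].
  - by rewrite natrB ?pchar_Fp_0 ?sub0r ?sqrrN -?natrX//; lia.
  - exact: dvdF.
  - exact: dvdF.
have [p8|p8] := eqVneq (p %% 8)%N 5%N.
  apply: (seed 4 ((3 * p).+1 %/ 4) 3 16)%N => //; try lia.
  - by rewrite -natrX.
  - exact: dvdF.
  (* [16 + 1 = 17] has a prime factor above 7, so the congruence modulo 8 is needed. *)
  - apply/negP => p17; have p_le : (p <= 17)%N by exact: dvdn_leq p17.
    have p13 : p = 13%N by lia.
    by rewrite p13 in p17.
have p30 : (p %% 3 != 0)%N.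
  apply/eqP => h; have : (3 %| p)%N by rewrite /dvdn h.
  by rewrite dvdn_prime2// => /eqP e; rewrite -e in p7.
have [k pk] : exists k, (p = 24 * k + 17)%N by exists (p %/ 24)%N; lia.
apply: (seed 12 ((7 * p).+1 %/ 12) 7 144)%N => //; try lia.
- by rewrite -natrX.
(* No divisor of [143 = 11 * 13] or [145 = 5 * 29] is 17 modulo 24. *)
- rewrite dvdn_divisors//; apply/negP.
  have -> : divisors 144.-1 = [:: 1; 11; 13; 143]%N by vm_compute.
  by rewrite !inE; lia.
- rewrite dvdn_divisors//; apply/negP.
  have -> : divisors 144.+1 = [:: 1; 5; 29; 145]%N by vm_compute.
  by rewrite !inE; lia.
Qed.

(** * Building a [p]-adic integer from its digits *)

Definition digit_sum (p : nat) (d : nat -> nat) (n : nat) : nat :=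
  (\sum_(0 <= i < n) d i * p ^ i)%N.

Lemma digit_sumD (p : nat) (d : nat -> nat) (m n : nat) :
  (digit_sum p d (m + n) =
   digit_sum p d m + p ^ m * digit_sum p (fun i => d (i + m)) n)%N.
Proof.
rewrite /digit_sum (@big_cat_nat _ _ _ m)//= ?leq_addr//; congr addn.
rewrite -{1}[m]add0n big_addn addKn big_distrr/=.
by apply: eq_bigr => i _; rewrite expnD; lia.
Qed.

Lemma Zp_nat_val (q q' k : nat) : (1 < q)%N -> (q %| q')%N -> (1 < q')%N ->
  ((k%:R : 'Z_q') : nat)%:R = k%:R :> 'Z_q.
Proof.
by move=> q1 qq' q'1; apply/(Zp_nat_eqP _ _ q1); rewrite val_Zp_nat// modn_dvdm.
Qed.

Lemma expn_gt1 (p : nat) (p_gt1 : (1 < p)%N) n : (1 < p ^ n.+1)%N.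
Proof. by rewrite -(exp1n n.+1) ltn_exp2r. Qed.

Lemma digit_sum_compat (p : nat) (p_gt1 : (1 < p)%N) (d : nat -> nat) n :
  (((digit_sum p d n.+2)%:R : 'Z_(p ^ n.+2)) : nat)%:R =
  (digit_sum p d n.+1)%:R :> 'Z_(p ^ n.+1).
Proof.
rewrite Zp_nat_val ?expn_gt1 ?dvdn_exp2l//.
apply/(Zp_nat_eqP _ _ (expn_gt1 p_gt1 n)).
by rewrite -[n.+2]addn1 digit_sumD mulnC addnC modnMDl.
Qed.

Definition of_digits (p : nat) (p_gt1 : (1 < p)%N) (d : nat -> nat) :
    padic_int p :=
  PadicInt (digit_sum_compat p_gt1 d).

Lemma residue_nat (p n k : nat) : residue (k%:R : padic_int p) n = k%:R.
Proof.
by elim: k => [//|k IH]; rewrite !mulrS -IH.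
Qed.

(** Exhibits the tail as a multiple of [p ^ m], the form in which cosets define the topology. *)
Lemma of_digits_split (p : nat) (p_gt1 : (1 < p)%N) (d : nat -> nat) m :
  of_digits p_gt1 d =
  (digit_sum p d m)%:R + p%:R ^+ m * of_digits p_gt1 (fun i => d (i + m)%N).
Proof.
rewrite -natrX; apply: padic_intP => n.
transitivity (residue ((digit_sum p d m)%:R : padic_int p) n +
  residue ((p ^ m)%:R : padic_int p) n *
  residue (of_digits p_gt1 (fun i => d (i + m)%N)) n); last by [].
rewrite !residue_nat /= -natrM -natrD -digit_sumD.
(* The right side sums [m] more digits than the left; these contribute a multiple of [p ^ n.+1]. *)
apply/(Zp_nat_eqP _ _ (expn_gt1 p_gt1 n)).
by rewrite addnC digit_sumD mulnC addnC modnMDl.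
Qed.

Lemma of_digits_expansion (p : nat) (p_gt1 : (1 < p)%N) (d : nat -> 'I_p) :
  padic_expansion (of_digits p_gt1 d) d.
Proof.
move=> U [N _ NU]; exists N => //= n Nn; apply: NU.
apply: (@padic_coset_leq p _ _ _ Nn).
exists (- of_digits p_gt1 (fun i => d (i + n)%N)) => //.
rewrite (of_digits_split p_gt1 d n) mulrN addrK /series /= /digit_sum natr_sum.
by apply: eq_bigr => i _; rewrite natrM natrX.
Qed.

(** * The diagonal argument *)

Lemma countable_enum (T : choiceType) (x0 : T) (A : set T) :
  countable A -> exists z : nat -> T, forall x, A x -> exists k, z k = x.
Proof.
move=> /countable_injP[f f_inj].
(* Indices that [f] does not reach from [A] get the default [x0], possibly outside [A]. *)
exists (fun k => xget x0 [set x | A x /\ f x = k]) => x Ax; exists (f x).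
have [Ax' fx'] := @xgetPex _ x0 [set y | A y /\ f y = f x] (ex_intro _ x (conj Ax erefl)).
by apply: f_inj => //; rewrite inE.
Qed.

(** State [k] holds the truncations of [x] and its inverse to the positions 0 to [k]. [F] also sees
    the index, since its choice at step [k] must avoid [z k]. *)
Fixpoint lift_state (p : nat) (F : nat * (nat * nat) -> 'I_p * 'I_p)
    (s0 : nat * nat) (k : nat) : nat * nat :=
  if k is k'.+1 then
    let s := lift_state F s0 k' in
    (s.1 + (F (k', s)).1 * p ^ k, s.2 + (F (k', s)).2 * p ^ k)%N
  else s0.

Lemma even_digits_inv_avoids (p : nat) (z : nat -> padic_int p) :
  prime p -> (7 <= p)%N ->
  exists x, even_digits_inv p x /\ forall k, z k <> x.
Proof.
move=> p_pr p7; have p_gt1 := prime_gt1 p_pr.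
pose P k (s : nat * nat) := [/\ (s.1 * s.2 = 1 %[mod p ^ k.+1])%N,
  s.1%:R != s.2%:R :> 'F_p & s.1%:R != - s.2%:R :> 'F_p].
pose Q (ks : nat * (nat * nat)) (ab : 'I_p * 'I_p) := P ks.1 ks.2 ->
  [/\ ~~ odd ab.1, ~~ odd ab.2,
    ((ks.2.1 + ab.1 * p ^ ks.1.+1) * (ks.2.2 + ab.2 * p ^ ks.1.+1)
      = 1 %[mod p ^ ks.1.+2])%N &
    residue (z ks.1) ks.1.+1 != (ks.2.1 + ab.1 * p ^ ks.1.+1)%:R].
have [F FP] : {F & forall ks, Q ks (F ks)}.
  apply: choice => -[k [X Y]]; rewrite /Q /=.
  have [[XY1 XY XNY]|nP] := pselect (P k (X, Y)); last first.
    (* Off [P] nothing is required of the digits; the seed only supplies some element of ['I_p]. *)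
    by have [a _] := even_seed p_pr p7; exists (a, a) => /nP.
  have [a [b [a' [b' [aa' /and4P[oa ob oa' ob'] h h']]]]] :=
    even_lifts p_pr p7 XY1 XY XNY.
  (* The two candidates differ modulo [p ^ k.+2], so at most one of them agrees with [z k]. *)
  have [e|ne] := eqVneq (residue (z k) k.+1) (X + a * p ^ k.+1)%:R;
    last by exists (a, b).
  exists (a', b') => _; split=> //=; rewrite e; apply: contra aa' => /eqP.
  move=> /(Zp_nat_eqP _ _ (expn_gt1 p_gt1 k.+1))/eqP.
  rewrite eqn_modDl !modn_small ?(expnS p k.+1) ?ltn_pmul2r ?expn_gt0 ?prime_gt0//.
  by rewrite eqn_pmul2r ?expn_gt0 ?prime_gt0.
have [x0 [y0 [ox0 oy0 xy0 x0y0 x0Ny0]]] := even_seed p_pr p7.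
pose s := lift_state F (x0 : nat, y0 : nat).
have sP k : P k (s k).
  elim: k => [|k IH]; first by rewrite /P /= expn1.
  have [_ _ h _] := FP (k, s k) IH; split=> //=.
  (* New digits carry a positive power of [p], so the residues modulo [p] remain those of the
     seed. *)
  - rewrite !natrD !natrM !natrX pchar_Fp_0// expr0n/= !mulr0 !addr0.
    by case: IH.
  - rewrite !natrD !natrM !natrX pchar_Fp_0// expr0n/= !mulr0 !addr0.
    by case: IH.
pose d k := if k is k'.+1 then (F (k', s k')).1 else x0.
pose e k := if k is k'.+1 then (F (k', s k')).2 else y0.
have dE k : digit_sum p d k.+1 = (s k).1.
  rewrite /digit_sum; elim: k => [|k IH]; first by rewrite big_nat1 expn0 muln1.
  by rewrite big_nat_recr//= IH.
have eE k : digit_sum p e k.+1 = (s k).2.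
  rewrite /digit_sum; elim: k => [|k IH]; first by rewrite big_nat1 expn0 muln1.
  by rewrite big_nat_recr//= IH.
pose x := of_digits p_gt1 d; pose y := of_digits p_gt1 e.
have xy : x * y = 1.
  apply: padic_intP => n; rewrite -[RHS](residue_nat p n 1).
  transitivity (residue x n * residue y n); first by [].
  rewrite residue_nat /= dE eE -natrM.
  by apply/(Zp_nat_eqP _ _ (expn_gt1 p_gt1 n)); case: (sP n).
have xU : x \is a GRing.unit by apply/unitrP; exists y; rewrite mulrC xy.
have xV : x^-1 = y by rewrite -[LHS]mulr1 -xy mulKr.
exists x; split.
  split=> //; exists d, e; split; first exact: of_digits_expansion.
    by rewrite xV; exact: of_digits_expansion.
  by case=> [//|k]; have [] := FP (k, s k) (sP k).
move=> k zx; have [_ _ _] := FP (k, s k) (sP k).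
by rewrite /= zx /= dE => /eqP.
Qed.

Theorem theoremA1 (p : nat) (p_prime : prime p) (p_ge7 : (7 <= p)%N) :
  ~ countable (even_digits_inv p).
Proof.
move=> /(countable_enum (0 : padic_int p))[z zP].
have [x [Kx zx]] := even_digits_inv_avoids z p_prime p_ge7.
by have [k /zx] := zP x Kx.
Qed.
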